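(* Let $G$ be a finitely generated group that can be written as a group extension \[ 1 \longrightarrow K \stackrel{i}{\longrightarrow} G \stackrel{f}{\longrightarrow} \Gamma \longrightarrow 1 \] where $K$ is a finitely generated group. Assume furthermore that $b_1(G) > b_1(\Gamma) > 0$. Then $G$ algebraically fibers.
   Context: For a finitely generated group $H$, $b_1(H) = \dim_{\mathbb{R}} H^1(H;\mathbb{R})$ denotes its first Betti number. A finitely generated group $G$ is said to algebraically fiber if there exists an epimorphism $\phi\colon G \to \mathbb{Z}$ with finitely generated kernel. *)

(* Defs.v *)
From HB Require Import structures.
From mathcomp Require Import all_boot all_order all_algebra.
From mathcomp Require Import boolp classical_sets functions reals.

Set Implicit Arguments.
Unset Strict Implicit.
Unset Printing Implicit Defensive.

Import GRing.Theory.
Local Open Scope classical_set_scope.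
Local Open Scope ring_scope.

Definition generated (G : groupType) (A : set G) : set G :=
  smallest (fun H : set G => group_closed [in H]) A.

Definition finitely_generated (G : groupType) (H : set G) : Prop :=
  exists s : seq G, generated [set` s] = H.

Definition fg_group (G : groupType) : Prop := finitely_generated [set: G].

Definition hom_kernel (G H : groupType) (f : {multiplicative G -> H}) : set G :=
  f @^-1` [set 1%g].

Definition epimorphism (G H : groupType) (f : {multiplicative G -> H}) : Prop :=
  forall y : H, exists x : G, f x = y.

Definition group_extension (K G Q : groupType)
    (i : {multiplicative K -> G}) (f : {multiplicative G -> Q}) : Prop :=
  [/\ injective i, range i = hom_kernel f & epimorphism f].

(* Inhomogeneous cochains of H with coefficients in the trivial H-module R.
   As g acts as the identity, the general formulas (d r)(g) = g.r - r and
   (d c)(g, h) = g.c(h) - c(gh) + c(g) become the following; in particular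
   the 1-coboundaries all vanish. *)
Definition cobord0 (R : realType) (H : groupType) (r : R) : H -> R^o :=
  fun g => r - r.

Definition cobord1 (R : realType) (H : groupType) (c : H -> R^o) :
    H -> H -> R^o :=
  fun g h => c h - c (g * h)%g + c g.

Definition cocycles1 (R : realType) (H : groupType) : set (H -> R^o) :=
  [set c | forall g h : H, cobord1 c g h = 0].

Definition coboundaries1 (R : realType) (H : groupType) : set (H -> R^o) :=
  range (@cobord0 R H).

(* For linear subspaces B `<=` Z of V: dim (Z / B) = n, witnessed by vectors of
   Z whose classes modulo B form a basis of Z / B. *)
Definition quotient_dim (R : realType) (V : lmodType R) (Z B : set V)
    (n : nat) : Prop :=
  exists c : 'I_n -> V,
    [/\ forall i, Z (c i),
        forall a : 'I_n -> R, B (\sum_(i < n) a i *: c i) ->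
          forall i, a i = 0
      & forall z, Z z -> exists a : 'I_n -> R,
          B (z - \sum_(i < n) a i *: c i)].

(* dim H^1(H; R), with the convention that it is 0 when this dimension is
   infinite, which does not happen for finitely generated H. *)
Definition b1 (R : realType) (H : groupType) : nat :=
  xget 0%N [set n | quotient_dim (@cocycles1 R H) (@coboundaries1 R H) n].

Definition algebraically_fibers (G : groupType) : Prop :=
  exists phi : {multiplicative G -> Algebra.to_multiplicative int},
    epimorphism phi /\ finitely_generated (hom_kernel phi).

(* Main.v *)
From HB Require Import structures.
Require Import Defs.
From mathcomp Require Import all_boot all_order all_algebra.
From mathcomp Require Import boolp classical_sets functions reals.
From mathcomp Require Import zify ring.

Set Implicit Arguments.
Unset Strict Implicit.
Unset Printing Implicit Defensive.

Import Order.TTheory GRing.Theory Num.Theory.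
Local Open Scope classical_set_scope.
Local Open Scope ring_scope.

(** Let [N] be the kernel of [f].  The hypotheses on Betti numbers enter
    through two characters of [G] with values in the integers: [alpha], which
    is not zero on [N], and [beta], which vanishes on [N] but not at some [t].
    If every real character of [G] vanished on [N], all of them would factor
    through [Gamma], and [b1 R G] independent characters would live in a space
    of dimension [b1 R Gamma] ([char_nonzero_on_kernel]); a nonzero character
    of [Gamma] gives the other one.  Real values become integral because the
    image of a finitely generated group spans a finite-dimensional rational
    subspace of the reals, so that a rational functional not vanishing at a
    chosen value exists there, and the denominators are bounded
    ([int_char_of_real]).

    Replacing [alpha] by [beta t * alpha - alpha t * beta] makes it vanish at
    [t] while it stays nonzero on [N].  The claim is that [chi = alpha + n beta]
    has a finitely generated kernel for suitable [n] of large absolute value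
    ([exists_char_kernel_fg]).  The kernel of [chi] is an extension of
    its image in [G / N] by [N0], the set of elements of [N] killed by [chi],
    and each piece is dealt with separately.

    For [N0]: choose [k] in [N] such that [chi k] generates the image of [N].
    Finitely many conjugates [u ^ (k ^ j)] do not suffice to generate [N0] in
    general, but [N0] is the increasing union of the subgroups generated by the
    bands [a <= j <= b].  Conjugation by [t] or its inverse enlarges every band
    by the same bounded amount [M], which depends on [alpha] restricted to [N]
    but not on [n] ([band_conj]).  For suitable [n] the element
    [s = t k^-m] lies in the kernel of [chi] with [m > M]: conjugation by [s]
    shifts bands by [m], which beats the enlargement [M].  So conjugation by
    [s] or its inverse carries the two extreme conjugates of any wide band
    into a narrower one, and one band together with [s] generates a group
    containing all of [N0] ([band_absorb]).

    For the kernel of [chi] modulo [N0]: if [chi w] generates the image of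
    [chi], the kernel is generated by the conjugates of finitely many elements
    by the powers of [w].  Some power of [w] equals [k nu] with [chi nu = 0],
    and [k] acts trivially on the kernel modulo [N0], because a commutator with
    an element of [N] lies in [N0].  Hence finitely many powers of [w] and the
    element [nu] suffice ([kernel_fg_mod_normal]). *)

(** * Subgroups as sets *)

Definition subgroup (G : groupType) (H : set G) : Prop := group_closed [in H].

Lemma subgroupP (G : groupType) (H : set G) :
  subgroup H <->
  [/\ H 1%g, forall x y, H x -> H y -> H (x * y)%g & forall x, H x -> H x^-1%g].
Proof.
split=> [[H1 HF]|[H1 HM HV]].
  have H1' : H 1%g by move: H1; rewrite inE.
  have HV x : H x -> H x^-1%g.
    move=> Hx; have := HF 1%g x; rewrite mul1g !inE; exact.
  split=> // x y Hx Hy; have := HF x y^-1%g.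
  by rewrite invgK !inE; apply => //; apply: HV.
split; first by rewrite inE.
by move=> x y; rewrite !inE => Hx Hy; apply: HM => //; apply: HV.
Qed.

Lemma group_morph1 (K G : groupType) (h : K -> G) :
  {morph h : x y / (x * y)%g} -> h 1%g = 1%g.
Proof. by move=> hM; apply: (mulgI (h 1%g)); rewrite -hM !mulg1. Qed.

Lemma group_morphV (K G : groupType) (h : K -> G) :
  {morph h : x y / (x * y)%g} -> {morph h : x / x^-1%g}.
Proof.
move=> hM x; apply: (mulgI (h x)).
by rewrite -hM !mulgV group_morph1.
Qed.

Section Subgroups.
Context (G : groupType).
Implicit Types (A H : set G) (x y g : G).

Lemma subgroup1 H : subgroup H -> H 1%g.
Proof. by move/subgroupP=> []. Qed.

Lemma subgroupM H x y : subgroup H -> H x -> H y -> H (x * y)%g.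
Proof. by move/subgroupP=> [_ + _]; exact. Qed.

Lemma subgroupV H x : subgroup H -> H x -> H x^-1%g.
Proof. by move/subgroupP=> [_ _]; exact. Qed.

Lemma subgroupJ H x y : subgroup H -> H x -> H y -> H (x ^ y)%g.
Proof.
move=> sH Hx Hy; rewrite conjgE.
by do 2?[apply: subgroupM => //]; apply: subgroupV.
Qed.

Lemma generated_subgroup A : subgroup (generated A).
Proof.
apply/subgroupP; split.
- by move=> H [sH _]; apply: subgroup1.
- by move=> x y Hx Hy H HA; apply: subgroupM; [case: HA|apply: Hx|apply: Hy].
- by move=> x Hx H HA; apply: subgroupV; [case: HA|apply: Hx].
Qed.

Lemma sub_generated A x : A x -> generated A x.
Proof. by move=> Ax H [_]; apply. Qed.

Lemma generated_min A H : subgroup H -> A `<=` H -> generated A `<=` H.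
Proof. by move=> sH AH x; apply; split. Qed.

Lemma subgroup_preimage (K : groupType) (h : K -> G) H :
  {morph h : x y / (x * y)%g} -> subgroup H -> subgroup (h @^-1` H).
Proof.
move=> hM sH; apply/subgroupP; split=> [|x y|x] /=.
- by rewrite group_morph1 //; apply: subgroup1.
- by rewrite hM; apply: subgroupM.
- by rewrite group_morphV //; apply: subgroupV.
Qed.

Lemma generatedJ A H g :
  subgroup H -> (forall x, A x -> H (x ^ g)%g) ->
  forall x, generated A x -> H (x ^ g)%g.
Proof.
move=> sH AH; apply: (@generated_min _ ((fun x => (x ^ g)%g) @^-1` H)) => //.
by apply: subgroup_preimage sH => x y; rewrite conjMg.
Qed.

End Subgroups.

(** * Integer powers *)

Definition zexp (G : groupType) (x : G) (j : int) : G :=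
  match j with Posz n => (x ^+ n)%g | Negz n => (x ^- n.+1)%g end.

Section IntegerPowers.
Context (G : groupType).
Implicit Types (H : set G) (x y g : G) (j i : int).

Lemma zexp0 x : zexp x 0 = 1%g. Proof. by []. Qed.

Lemma zexp1 x : zexp x 1 = x. Proof. exact: expg1. Qed.

Lemma zexpS x j : zexp x (j + 1) = (zexp x j * x)%g.
Proof.
case: j => [n|[|n]].
- by rewrite -PoszD addn1 /= expgSr.
- by rewrite /= expg1 mulVg.
- rewrite !NegzE (_ : - n.+2%:Z + 1 = - n.+1%:Z); last by lia.
  by rewrite -!NegzE /= (expgS x n.+1) invgM mulgVK.
Qed.

Lemma zexpB1 x j : zexp x (j - 1) = (zexp x j * x^-1)%g.
Proof. by rewrite -[j in RHS](subrK 1) zexpS mulgK. Qed.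

Lemma zexpD x i j : zexp x (i + j) = (zexp x i * zexp x j)%g.
Proof.
elim: j => [|n IH|n IH]; first by rewrite addr0 mulg1.
- by rewrite -addn1 PoszD addrA !zexpS IH mulgA.
- by rewrite -addn1 PoszD opprD addrA !zexpB1 IH mulgA.
Qed.

Lemma zexpN x j : zexp x (- j) = (zexp x j)^-1%g.
Proof. by apply: (mulgI (zexp x j)); rewrite -zexpD subrr mulgV. Qed.

Lemma subgroupZ H x j : subgroup H -> H x -> H (zexp x j).
Proof.
move=> sH Hx; elim: j => [|n IH|n IH]; first exact: subgroup1.
- by rewrite -addn1 PoszD zexpS; apply: subgroupM.
- rewrite -addn1 PoszD opprD zexpB1; apply: subgroupM => //.
  exact: subgroupV.
Qed.

End IntegerPowers.

Arguments zexp : simpl never.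

(** * Additive characters *)

Definition additive_char (G : groupType) (V : zmodType) (c : G -> V) : Prop :=
  {morph c : x y / (x * y)%g >-> x + y}.

Section AdditiveCharacters.
Context (G : groupType) (V : zmodType) (c : G -> V).
Context (cM : additive_char c).

Lemma char1 : c 1%g = 0.
Proof. by apply: (addrI (c 1%g)); rewrite -cM mulg1 addr0. Qed.

Lemma charV x : c x^-1%g = - c x.
Proof. by apply: (addrI (c x)); rewrite -cM mulgV char1 subrr. Qed.

Lemma charJ x y : c (x ^ y)%g = c x.
Proof. by rewrite conjgE !cM charV addrC addrK. Qed.

Lemma charZ x j : c (zexp x j) = c x *~ j.
Proof.
elim: j => [|n IH|n IH]; first by rewrite zexp0 char1 mulr0z.
- by rewrite -addn1 PoszD zexpS cM IH mulrzDr.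
- by rewrite -addn1 PoszD opprD zexpB1 cM IH mulrzDr charV mulrNz.
Qed.

Lemma char_kernel_subgroup : subgroup [set x | c x = 0].
Proof.
apply/subgroupP; split=> [|x y /= cx cy|x /= cx].
- exact: char1.
- by rewrite cM cx cy addr0.
- by rewrite charV cx oppr0.
Qed.

End AdditiveCharacters.

(** An element of least positive value works: Euclidean division by that value
    leaves a remainder which is again a value on [H]. *)
Lemma char_image_cyclic (G : groupType) (chi : G -> int) (H : set G) h :
  additive_char chi -> subgroup H -> H h -> chi h != 0 ->
  exists w, [/\ H w, 0 < chi w & forall g, H g -> (chi w %| chi g)%Z].
Proof.
move=> chiM sH Hh h0.
pose P n := `[< exists2 g, H g & chi g = n.+1%:Z >].
have exP : exists n, P n.
  exists `|chi h|.-1; apply/asboolP; have [h_gt0|h_lt0] := ltP 0 (chi h).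
    by exists h => //; lia.
  by exists h^-1%g; [apply: subgroupV|rewrite charV //; lia].
case: (ex_minnP exP) => n /asboolP[w Hw chiw] nmin.
exists w; split=> //; first by rewrite chiw.
move=> g Hg; apply/dvdz_mod0P; pose r := (g * zexp w (- (chi g %/ chi w)%Z))%g.
have Hr : H r by apply: subgroupM => //; apply: subgroupZ.
have chir : chi r = (chi g %% chi w)%Z.
  by rewrite /r chiM charZ // {1}(divz_eq (chi g) (chi w)) -mulrzr intz; ring.
have w0 : chi w != 0 by rewrite chiw.
have := modz_ge0 (chi g) w0; have := ltz_mod (chi g) w0.
rewrite -chir => r_lt r_ge0.
apply: contraTeq r_lt => r0.
have /nmin : P `|chi r|.-1 by apply/asboolP; exists r => //; lia.
by lia.
Qed.

(** * Bands of conjugates *)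

Definition band (G : groupType) (S : seq G) (k : G) (a b : int) : set G :=
  generated [set x | exists u j,
    [/\ u \in S, a <= j, j <= b & x = (u ^ zexp k j)%g]].

Section Bands.
Context (G : groupType) (S : seq G) (k : G).
Implicit Types (x y t : G) (a b i j : int).

Lemma band_subgroup a b : subgroup (band S k a b).
Proof. exact: generated_subgroup. Qed.

Lemma band_gen a b u j : u \in S -> a <= j -> j <= b ->
  band S k a b (u ^ zexp k j)%g.
Proof. by move=> uS aj jb; apply: sub_generated; exists u, j. Qed.

Lemma band_mono a b a' b' x : a' <= a -> b <= b' ->
  band S k a b x -> band S k a' b' x.
Proof.
move=> ha hb; apply: generated_min; first exact: band_subgroup.
by move=> _ [u [j [uS aj jb ->]]]; apply: band_gen => //; lia.
Qed.

Lemma band_shift i a b x :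
  band S k a b x -> band S k (a + i) (b + i) (x ^ zexp k i)%g.
Proof.
apply: generatedJ; first exact: band_subgroup.
move=> _ [u [j [uS aj jb ->]]]; rewrite -conjgM -zexpD.
by apply: band_gen => //; lia.
Qed.

Global Arguments band_shift i {a b x} _.

(** Conjugation by [t] replaces [k] by [k * c], so it replaces [zexp k j] by
    [zexp k j] times a product of the conjugates of [c] or its inverse by the
    powers of [k] between [0] and [j].  This is why the displacement [M] below
    does not grow with the band. *)
Lemma band_conj (M : nat) t a b x :
  (forall u, u \in S -> band S k (- M%:Z) M%:Z (u ^ t)%g) ->
  band S k (- M%:Z) M%:Z (k^-1 * k ^ t)%g ->
  a <= 0 -> 0 <= b -> band S k a b x ->
  band S k (a - M%:Z) (b + M%:Z) (x ^ t)%g.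
Proof.
move=> St; set c := (k^-1 * k ^ t)%g => ct a_le0 b_ge0.
have kt : (k ^ t)%g = (k * c)%g by rewrite /c mulVKg.
have pos (n : nat) : band S k (- M%:Z) (n%:Z + M%:Z)
    ((zexp k n%:Z)^-1 * zexp k n%:Z ^ t)%g.
  elim: n => [|n IH].
    rewrite zexp0 conj1g mulVg; exact: subgroup1 (band_subgroup _ _).
  rewrite -addn1 PoszD zexpS conjMg invgM kt.
  set y := (_ * _ ^ t)%g in IH.
  have -> : (zexp k n ^ t = zexp k n * y)%g by rewrite /y mulVKg.
  have -> : (k^-1 * (zexp k n)^-1 * (zexp k n * y * (k * c)))%g
      = (y ^ zexp k 1 * c)%g.
    by rewrite zexp1 conjgE -!mulgA mulKg.
  apply: (subgroupM (band_subgroup _ _)).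
  - by apply: band_mono _ _ (band_shift 1 IH); lia.
  - by apply: band_mono _ _ ct; lia.
have neg (n : nat) : band S k (- n%:Z - M%:Z) M%:Z
    ((zexp k (- n%:Z))^-1 * zexp k (- n%:Z) ^ t)%g.
  elim: n => [|n IH].
    rewrite oppr0 zexp0 conj1g mulVg; exact: subgroup1 (band_subgroup _ _).
  rewrite -addn1 PoszD opprD zexpB1 conjMg invgM conjVg kt.
  set y := (_ * _ ^ t)%g in IH.
  have -> : (zexp k (- n%:Z) ^ t = zexp k (- n%:Z) * y)%g by rewrite /y mulVKg.
  set z := zexp k (- n%:Z).
  have -> : ((k^-1)^-1 * z^-1 * (z * y * (k * c)^-1))%g
      = ((y * c^-1) ^ zexp k (-1))%g.
    by rewrite zexpN zexp1 conjgE !invgK !invgM -!mulgA mulKg.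
  apply: (@band_mono (- n%:Z - M%:Z + -1) (M%:Z + -1)); try lia.
  apply: band_shift; apply: (subgroupM (band_subgroup _ _)) => //.
  apply: (subgroupV (band_subgroup _ _)).
  by apply: band_mono _ _ ct; lia.
apply: generatedJ; first exact: band_subgroup.
move=> _ [u [j [uS aj jb ->]]].
have yj : band S k (a - M%:Z) (b + M%:Z) ((zexp k j)^-1 * zexp k j ^ t)%g.
  case: j aj jb => n aj jb; first by apply: band_mono _ _ (pos n); lia.
  by rewrite NegzE; apply: band_mono _ _ (neg n.+1); lia.
set y := (_ * _)%g in yj.
have -> : ((u ^ zexp k j) ^ t = ((u ^ t) ^ zexp k j) ^ y)%g.
  by rewrite -!conjgM /y mulVKg conjgC.
apply: (subgroupJ (band_subgroup _ _)) => //.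
by apply: band_mono _ _ (band_shift j (St u uS)); lia.
Qed.

(** With [s = t k^-m] and [m] larger than the displacement [M] of bands under
    [t], conjugation by [s] moves the right end of a band to the left, and
    conjugation by its inverse moves the left end to the right; the other end
    stays within reach as soon as the band is wide. *)
Lemma band_absorb (M : nat) (m : int) t (H : set G) :
  (forall u, u \in S -> band S k (- M%:Z) M%:Z (u ^ t)%g) ->
  band S k (- M%:Z) M%:Z (k^-1 * k ^ t)%g ->
  (forall u, u \in S -> band S k (- M%:Z) M%:Z (u ^ t^-1)%g) ->
  band S k (- M%:Z) M%:Z (k^-1 * k ^ t^-1)%g ->
  M%:Z < m -> subgroup H -> H (t * zexp k (- m))%g ->
  band S k (- (M%:Z + m)) (M%:Z + m) `<=` H ->
  forall n : nat, band S k (- n%:Z) n%:Z `<=` H.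
Proof.
move=> St kt SV kV Mm sH; set s := (t * _)%g => Hs base.
suff wide p : band S k (- (M%:Z + m + p%:Z)) (M%:Z + m + p%:Z) `<=` H.
  by move=> n x xn; apply: (wide n); apply: band_mono _ _ xn; lia.
elim: p => [|p IH]; first by rewrite addr0.
apply: generated_min => // _ [u [j [uS j_ge j_le ->]]].
set q := M%:Z + m + p%:Z in IH.
have [jq|qj] := leP j q; last first.
  have uj : band S k 0 (q + 1) (u ^ zexp k j)%g by apply: band_gen => //; lia.
  have ujs : H ((u ^ zexp k j) ^ s)%g.
    rewrite /s conjgM; apply: IH.
    have ht : band S k (0 - M%:Z) (q + 1 + M%:Z) ((u ^ zexp k j) ^ t)%g.
      by apply: band_conj _ _ _ _ uj => //; lia.
    by apply: band_mono _ _ (band_shift (- m) ht); lia.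
  by rewrite -(conjgK s (u ^ _)%g); apply: subgroupJ => //; apply: subgroupV.
have [qj|jq'] := leP (- q) j; first by apply: IH; apply: band_gen.
have ujs : H ((u ^ zexp k j) ^ s^-1)%g.
  rewrite /s invgM zexpN invgK !conjgM -[X in (X ^ _)%g]conjgM -zexpD; apply: IH.
  have uj : band S k (m - q - 1) 0 (u ^ zexp k (j + m))%g.
    by apply: band_gen => //; lia.
  have ht : band S k (m - q - 1 - M%:Z) (0 + M%:Z) ((u ^ zexp k (j + m)) ^ t^-1)%g.
    by apply: band_conj _ _ _ _ uj => //; lia.
  by apply: band_mono _ _ ht; lia.
by rewrite -(conjgKV s (u ^ _)%g); apply: subgroupJ.
Qed.

(** The bands are nested, so finitely many elements of their union lie in a
    common one. *)
Lemma band_bound (B : set G) (X : seq G) :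
  B = [set x | exists n : nat, band S k (- n%:Z) n%:Z x] ->
  (forall x, x \in X -> B x) ->
  exists M : nat, forall x, x \in X -> band S k (- M%:Z) M%:Z x.
Proof.
move=> ->; elim: X => [_|x X IH XB]; first by exists 0%N.
have [|M MX] := IH; first by move=> y yX; apply: XB; rewrite inE yX orbT.
have [n xn] := XB x (mem_head _ _); exists (n + M)%N => y.
by rewrite inE => /orP[/eqP->|/MX yM];
  [apply: band_mono _ _ xn|apply: band_mono _ _ yM]; lia.
Qed.

Lemma band_finite (p : nat) : exists F : seq G, [/\
  forall x, x \in F -> band S k (- p%:Z) p%:Z x &
  band S k (- p%:Z) p%:Z `<=` generated [set` F]].
Proof.
pose pw (e : nat) := zexp k (e%:Z - p%:Z).
exists [seq (u ^ pw e)%g | u <- S, e <- iota 0 (p + p + 1)]; split.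
  move=> _ /allpairsP[[u e] /= [uS + ->]]; rewrite mem_iota => ep.
  by apply: band_gen => //; lia.
apply: generated_min; first exact: generated_subgroup.
move=> _ [u [j [uS pj jp ->]]]; apply: sub_generated => /=.
apply/allpairsP; exists (u, absz (j + p%:Z)) => /=; split=> //.
  by rewrite mem_iota; lia.
by rewrite /pw; congr (_ ^ zexp k _)%g; lia.
Qed.

End Bands.

(** * Kernels of characters *)

(** A subgroup of the kernel that [w] normalizes is all of the kernel of [chi]
    on a group generated by [A] as soon as every generator lies in it up to a
    power of [w]: its products with the powers of [w] then form a subgroup. *)
Lemma kernel_sub (G : groupType) (chi : G -> int) (A P : set G) w :
  additive_char chi -> chi w != 0 -> subgroup P ->
  (forall x, P x -> chi x = 0) ->
  (forall x, P x -> P (x ^ w)%g) -> (forall x, P x -> P (x ^ w^-1)%g) ->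
  (forall x, A x -> exists j, P (x * zexp w j)%g) ->
  forall g, generated A g -> chi g = 0 -> P g.
Proof.
move=> chiM w0 sP P0 Pw PwV AP g Ag chig.
have PZ x j : P x -> P (x ^ zexp w j)%g.
  move=> Px; elim: j => [|n IH|n IH]; first by rewrite zexp0 conjg1.
  - by rewrite -addn1 PoszD zexpS conjgM; apply: Pw.
  - by rewrite -addn1 PoszD opprD zexpB1 conjgM; apply: PwV.
have [j Pgj] : exists j, P (g * zexp w j)%g.
  apply: (@generated_min _ A [set x | exists j, P (x * zexp w j)%g]) Ag => //.
  apply/subgroupP; split=> [|x y /= [i Px] [j Py]|x /= [i Px]].
  - by exists 0; rewrite zexp0 mulg1; apply: subgroup1.
  - exists (j + i).
    have -> : (x * y * zexp w (j + i)
        = x * zexp w i * (y * zexp w j) ^ zexp w i)%g.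
      by rewrite zexpD conjgE -!mulgA mulVKg.
    by apply: subgroupM => //; apply: PZ.
  - exists (- i); rewrite zexpN -invgM.
    have -> : (zexp w i * x = (x * zexp w i) ^ zexp w (- i))%g.
      by rewrite conjgE zexpN invgK -!mulgA mulgV mulg1.
    by apply: subgroupV => //; apply: PZ.
have := P0 _ Pgj; rewrite chiM charZ // chig add0r => /eqP.
by rewrite mulrz_eq0 (negPf w0) orbF => /eqP j0; rewrite j0 zexp0 mulg1 in Pgj.
Qed.

Section NormalSubgroup.
Context (G : groupType) (N : set G).
Context (sN : subgroup N) (nN : forall x g, N x -> N (x ^ g)%g).

(** The elements of [N] killed by [alpha] are exhausted by the bands built on the
    generators of [N] corrected by powers of [k].  The bound [M] is found before
    [m] is chosen: this order of quantifiers is what allows the character of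
    [G] to be adapted to [M] afterwards. *)
Lemma normal_kernel_absorbed (sK : seq G) (alpha : G -> int) k t :
  additive_char alpha -> N = generated [set` sK] ->
  N k -> 0 < alpha k -> (forall x, N x -> (alpha k %| alpha x)%Z) ->
  exists M : nat, forall m : int, M%:Z < m ->
  exists F : seq G, (forall x, x \in F -> N x /\ alpha x = 0) /\
    forall H : set G, subgroup H -> H (t * zexp k (- m))%g ->
      (forall x, x \in F -> H x) ->
      forall x, N x -> alpha x = 0 -> H x.
Proof.
move=> aM defN Nk ak_gt0 ak_dvd; set B := [set x | N x /\ alpha x = 0].
have ak0 : alpha k != 0 by rewrite gt_eqF.
have sB : subgroup B.
  have sker := char_kernel_subgroup aM.
  apply/subgroupP; split=> [|x y [Nx ax] [Ny ay]|x [Nx ax]].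
  - by split; [apply: subgroup1|apply: char1].
  - by split; [apply: subgroupM|apply: (subgroupM sker)].
  - by split; [apply: subgroupV|apply: (subgroupV sker)].
have nB x g : B x -> B (x ^ g)%g.
  by move=> [Nx ax]; split; [apply: nN|rewrite charJ].
have sKN x : x \in sK -> N x by move=> xK; rewrite defN; apply: sub_generated.
pose lvl x := (x * zexp k (- (alpha x %/ alpha k)%Z))%g.
pose S := map lvl sK.
have SB u : u \in S -> B u.
  move=> /mapP[x xK ->]; split.
    by apply: subgroupM; [|apply: sKN|apply: subgroupZ].
  rewrite aM charZ // -mulrzr intz mulrN mulrC divzK ?subrr //.
  exact/ak_dvd/sKN.
have bandB a b x : band S k a b x -> B x.
  move: x; apply: generated_min => // _ [u [j [uS _ _ ->]]].
  exact/nB/SB.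
pose U := [set x | exists n : nat, band S k (- n%:Z) n%:Z x].
have sU : subgroup U.
  apply/subgroupP; split=> [|x y [p xp] [q yq]|x [p xp]].
  - by exists 0%N; apply: (subgroup1 (band_subgroup _ _ _ _)).
  - exists (p + q)%N; apply: (subgroupM (band_subgroup _ _ _ _)).
      by apply: band_mono _ _ xp; lia.
    by apply: band_mono _ _ yq; lia.
  - by exists p; apply: (subgroupV (band_subgroup _ _ _ _)).
have BU : B = U.
  apply/seteqP; split=> x; last by move=> [n xn]; apply: bandB xn.
  move=> [Nx ax]; rewrite defN in Nx.
  apply: (kernel_sub aM ak0 sU) Nx ax => [y [n yn]|y [n yn]|y [n yn]|y yK].
  - by case: (bandB _ _ _ yn).
  - exists n.+1; have -> : (y ^ k = y ^ zexp k 1)%g by rewrite zexp1.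
    by apply: band_mono _ _ (band_shift 1 yn); lia.
  - exists n.+1; have -> : (y ^ k^-1 = y ^ zexp k (- 1))%g by rewrite zexpN zexp1.
    by apply: band_mono _ _ (band_shift (- 1) yn); lia.
  - exists (- (alpha y %/ alpha k)%Z), 0%N; rewrite -[X in band _ _ _ _ X]conjg1.
    by rewrite -(zexp0 k); apply: band_gen => //; apply: map_f.
have Bc g : B (k^-1 * k ^ g)%g.
  split; first by apply: subgroupM; [|apply: subgroupV|apply: nN].
  by rewrite aM charV // charJ // addNr.
pose X := (k^-1 * k ^ t)%g :: (k^-1 * k ^ t^-1)%g ::
  ([seq (u ^ t)%g | u <- S] ++ [seq (u ^ t^-1)%g | u <- S]).
have [M MX] : exists M : nat, forall x, x \in X -> band S k (- M%:Z) M%:Z x.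
  apply: band_bound BU _ => x; rewrite !inE mem_cat.
  case/or4P=> [/eqP->|/eqP->|/mapP[u uS ->]|/mapP[u uS ->]] //.
    exact/nB/SB.
  exact/nB/SB.
(* The band of half-width [M + m] is the one that absorption starts from. *)
exists M => m Mm.
have [F [FB BF]] := band_finite S k (M + `|m|)%N.
exists F; split=> [x /FB/bandB //|H sH Hs FH x Nx ax].
have [n xn] : U x by rewrite -BU.
have St u : u \in S -> band S k (- M%:Z) M%:Z (u ^ t)%g.
  move=> uS; apply: MX; rewrite !inE mem_cat.
  by rewrite (map_f (fun v => v ^ t)%g uS) ?orbT.
have StV u : u \in S -> band S k (- M%:Z) M%:Z (u ^ t^-1)%g.
  move=> uS; apply: MX; rewrite !inE mem_cat.
  by rewrite (map_f (fun v => v ^ t^-1)%g uS) ?orbT.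
apply: (band_absorb St _ StV _ Mm sH Hs) xn.
- by apply: MX; rewrite !inE eqxx.
- by apply: MX; rewrite !inE eqxx orbT.
- move=> y ym; apply: (generated_min sH FH); apply: BF.
  by apply: band_mono _ _ ym; lia.
Qed.

(** Let [P] be generated by [F] and the kernel of [chi] in [N].  It is
    normalized by [N], because [x^-1 * x ^ h] lies in that kernel for [h] in
    [N].  As a power of [w] is in [N] times an element of [P], only finitely
    many conjugates by powers of [w] have to be put in [F] for [w] to
    normalize [P]. *)
Lemma kernel_fg_mod_normal (sG : seq G) (chi : G -> int) k :
  additive_char chi -> generated [set` sG] = setT -> N k -> 0 < chi k ->
  exists F : seq G, (forall x, x \in F -> chi x = 0) /\
    forall H : set G, subgroup H -> (forall x, x \in F -> H x) ->
      (forall x, N x -> chi x = 0 -> H x) ->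
      forall g, chi g = 0 -> H g.
Proof.
move=> chiM genG Nk chik.
have sT : subgroup [set: G] by apply/subgroupP.
have [w [_ chiw w_dvd]] :=
  char_image_cyclic chiM sT (I : [set: G] k) (lt0r_neq0 chik).
have w0 : chi w != 0 by rewrite gt_eqF.
have [D D_gt0 chikD] : exists2 D : nat, (0 < D)%N & chi k = chi w * D%:Z.
  have /dvdzP[q qE] := w_dvd k I; exists `|q|%N; last by nia.
  by nia.
pose nu := (k^-1 * zexp w D%:Z)%g.
have wD : zexp w D%:Z = (k * nu)%g by rewrite /nu mulVKg.
have chinu : chi nu = 0.
  by rewrite chiM charV // charZ // chikD -mulrzr intz addNr.
pose lvl x := (x * zexp w (- (chi x %/ chi w)%Z))%g.
have chilvl x : chi (lvl x) = 0.
  rewrite chiM charZ // -mulrzr intz mulrN mulrC divzK ?subrr //.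
  exact: w_dvd.
pose F := nu :: [seq (lvl x ^ zexp w e%:Z)%g | x <- sG, e <- iota 0 D].
have Flvl x e : x \in sG -> (e < D)%N -> (lvl x ^ zexp w e%:Z)%g \in F.
  move=> xG eD; rewrite inE; apply/orP; right; apply/allpairsP.
  by exists (x, e); split=> //=; rewrite mem_iota.
have F0 x : x \in F -> chi x = 0.
  rewrite inE => /orP[/eqP->//|/allpairsP[[y e] /= [_ _ ->]]].
  by rewrite charJ.
exists F; split=> // H sH FH NH.
pose A := [set x | x \in F \/ (N x /\ chi x = 0)].
pose P := generated A; have sP : subgroup P by apply: generated_subgroup.
have PF x : x \in F -> P x by move=> xF; apply: sub_generated; left.
have PN x : N x -> chi x = 0 -> P x.
  by move=> Nx x0; apply: sub_generated; right.
have PJN x h : N h -> P x -> P (x ^ h)%g.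
  move=> Nh Px; rewrite -(mulVKg x (x ^ h)%g); apply: (subgroupM sP) => //.
  apply: PN; last by rewrite chiM charV // charJ // addNr.
  have -> : (x^-1 * x ^ h = h^-1 ^ x * h)%g by rewrite !conjgE !mulgA.
  by apply: subgroupM => //; apply: nN; apply: subgroupV.
have Pnu : P nu by apply: PF; rewrite mem_head.
have PwD x : P x -> P (x ^ zexp w D%:Z)%g.
  by move=> Px; rewrite wD conjgM; apply: (subgroupJ sP) => //; apply: PJN.
have PwDV x : P x -> P (x ^ (zexp w D%:Z)^-1)%g.
  move=> Px; rewrite wD invgM conjgM; apply: PJN; first exact: subgroupV.
  by apply: (subgroupJ sP) => //; apply: (subgroupV sP).
have nuJ j : P (nu ^ zexp w j)%g.
  have -> : (nu ^ zexp w j = (k^-1 ^ zexp w j * k) * nu)%g.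
    rewrite /nu -mulgA mulVKg conjMg; congr (_ * _)%g.
    by rewrite conjgE -zexpN -!zexpD addrCA addNr addr0.
  apply: (subgroupM sP) => //; apply: PN.
    by apply: subgroupM => //; apply: nN; apply: subgroupV.
  by rewrite chiM charJ // charV // addNr.
have Pw x : P x -> P (x ^ w)%g.
  apply: generatedJ => // y [|[Ny y0]]; last first.
    by apply: PN; [apply: nN|rewrite charJ].
  rewrite inE => /orP[/eqP->|/allpairsP[[z e] /= [zG + ->]]].
    by rewrite -(zexp1 w); apply: nuJ.
  rewrite mem_iota add0n -conjgM -zexpS => /= eD.
  have [e1D|D_le] := ltnP e.+1 D.
    by apply: PF; rewrite -PoszD addn1; apply: Flvl.
  (* The last conjugate wraps around through [w ^ D = k * nu]. *)
  have -> : e%:Z + 1 = D%:Z by lia.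
  by have /PF := Flvl z 0%N zG D_gt0; rewrite zexp0 conjg1 => /PwD.
have PwV x : P x -> P (x ^ w^-1)%g.
  apply: generatedJ => // y [|[Ny y0]]; last first.
    by apply: PN; [apply: nN|rewrite charJ].
  rewrite inE => /orP[/eqP->|/allpairsP[[z e] /= [zG + ->]]].
    by rewrite -(zexp1 w) -zexpN; apply: nuJ.
  rewrite mem_iota add0n -conjgM -zexpB1 => /= eD.
  case: e eD => [|e] eD.
    have -> : 0%:Z + - 1 = D.-1%:Z - D%:Z by lia.
    by rewrite zexpD conjgM zexpN; apply: (PwDV _ (PF _ (Flvl _ _ zG _))); lia.
  have -> : e.+1%:Z + - 1 = e%:Z by lia.
  by apply: PF; apply: Flvl => //; lia.
have P0 x : P x -> chi x = 0.
  move: x; apply: (generated_min (char_kernel_subgroup chiM)) => x.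
  by case=> [/F0|[]].
have PH : P `<=` H by apply: generated_min => // x [/FH|[/NH]]; [|exact].
move=> g chig; apply: PH.
have genGg : generated [set` sG] g by rewrite genG.
apply: (kernel_sub chiM w0 sP P0 Pw PwV) genGg chig => x xG; exists (- (chi x %/ chi w)%Z).
by have /PF := Flvl x 0%N xG D_gt0; rewrite zexp0 conjg1.
Qed.

(** The multiple of [beta] is added to a character that vanishes at [t] and agrees
    with a multiple of [alpha] on [N]: the value at [t] can then be enlarged
    freely without changing the character on [N]. *)
Lemma exists_char_kernel_fg (sK sG : seq G) (alpha beta : G -> int) h t :
  N = generated [set` sK] -> generated [set` sG] = setT ->
  additive_char alpha -> additive_char beta ->
  N h -> alpha h != 0 ->
  (forall x, N x -> beta x = 0) -> beta t != 0 ->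
  exists2 chi : G -> int, additive_char chi &
    (exists g, chi g != 0) /\ finitely_generated [set x | chi x = 0].
Proof.
move=> defN genG aM bM Nh ah bN bt.
pose alpha' x := beta t * alpha x - alpha t * beta x.
have a'M : additive_char alpha' by move=> x y; rewrite /alpha' aM bM; ring.
have a'h : alpha' h != 0 by rewrite /alpha' (bN h) // mulr0 subr0 mulf_neq0.
have a't : alpha' t = 0 by rewrite /alpha'; ring.
have [k [Nk ak_gt0 ak_dvd]] := char_image_cyclic a'M sN Nh a'h.
have [M absorb] := normal_kernel_absorbed t a'M defN Nk ak_gt0 ak_dvd.
(* The integer [m] is determined by [chi t = chi k * m] for the [chi] below. *)
pose m := beta t ^+ 2 * (M%:Z + 1).
have Mm : M%:Z < m.
  have : 0 < beta t ^+ 2 by rewrite exprn_even_gt0.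
  rewrite /m; nia.
have [F1 [F1P F1H]] := absorb m Mm.
pose chi x := alpha' x + alpha' k * beta t * (M%:Z + 1) * beta x.
have chiM : additive_char chi by move=> x y; rewrite /chi a'M bM; ring.
have chiN x : N x -> chi x = alpha' x by move=> /bN bx; rewrite /chi bx mulr0 addr0.
have chik : 0 < chi k by rewrite chiN.
pose s := (t * zexp k (- m))%g.
have chis : chi s = 0.
  rewrite chiM charZ // -mulrzr intz (chiN k) // /chi a't /m; ring.
have [F2 [F2P F2H]] := kernel_fg_mod_normal chiM genG Nk chik.
exists chi => //; split; first by exists k; rewrite gt_eqF.
exists (s :: F1 ++ F2); apply/seteqP; split.
  apply: (generated_min (char_kernel_subgroup chiM)) => x /=.
  rewrite inE mem_cat => /or3P[/eqP->//|/F1P[Nx ax]|/F2P//].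
  by rewrite chiN.
set Q := generated _; have sQ : subgroup Q by apply: generated_subgroup.
have FQ x : x \in s :: F1 ++ F2 -> Q x by move=> xF; apply: sub_generated.
apply: (F2H Q sQ) => [x xF|x Nx chix].
  by apply: FQ; rewrite inE mem_cat xF !orbT.
apply: (F1H Q sQ) => // [|y yF|]; last by rewrite -chiN.
  by apply: FQ; rewrite mem_head.
by apply: FQ; rewrite inE mem_cat yF orbT.
Qed.

End NormalSubgroup.

(** Dividing by a generator of the image makes the character surjective and
    preserves its kernel. *)
Lemma algebraically_fibers_of_char (G : groupType) (chi : G -> int) g :
  additive_char chi -> chi g != 0 ->
  finitely_generated [set x | chi x = 0] -> algebraically_fibers G.
Proof.
move=> chiM chig0 fgker.
have sT : subgroup [set: G] by apply/subgroupP.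
have [w [_ chiw w_dvd]] := char_image_cyclic chiM sT (I : [set: G] g) chig0.
have w0 : chi w != 0 by rewrite gt_eqF.
pose phi0 : G -> Algebra.to_multiplicative int := fun x => (chi x %/ chi w)%Z.
have phi0M : {morph phi0 : x y / (x * y)%g}.
  by move=> x y; rewrite /phi0 chiM divzDl // w_dvd.
pose phi : {multiplicative G -> Algebra.to_multiplicative int} :=
  HB.pack phi0 (isMultiplicative.Build G (Algebra.to_multiplicative int) phi0 phi0M).
exists phi; split.
  move=> j; exists (zexp w j).
  by rewrite /= /phi0 charZ // -mulrzr intz mulKz.
congr finitely_generated : fgker; apply/seteqP; split=> x /= chix.
  by rewrite /hom_kernel /= /phi0 chix div0z.
by rewrite -(divzK (w_dvd x I)) (chix : (chi x %/ chi w)%Z = 0) mul0r.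
Qed.

(** * From real to integral characters *)

(** Linearity over the rationals on the subspace [V]; the values of [l] outside
    [V] are arbitrary, which avoids subtypes. *)
Definition rat_linear_on (R : numFieldType) (V : set R) (l : R -> rat) : Prop :=
  [/\ V 0,
      forall q x y, V x -> V y -> V (ratr q * x + y)
    & forall q x y, V x -> V y -> l (ratr q * x + y) = q * l x + l y].

Lemma rat_linear0 (R : numFieldType) (V : set R) (l : R -> rat) :
  rat_linear_on V l -> l 0 = 0.
Proof.
move=> [V0 _ lL]; have := lL 1 0 0 V0 V0.
by rewrite mulr0 addr0 mul1r -[X in X = _]addr0 => /addrI.
Qed.

Lemma rat_linear_extend (R : numFieldType) (V : set R) (l : R -> rat) x r :
  rat_linear_on V l -> ~ V x ->
  exists V' l', [/\ rat_linear_on V' l', V `<=` V', V' x,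
    forall v, V v -> l' v = l v & l' x = r].
Proof.
move=> lV Vx; have l0 := rat_linear0 lV; case: lV => V0 VL lL.
have uniq v q v' q' : V v -> V v' -> v + ratr q * x = v' + ratr q' * x ->
    v = v' /\ q = q'.
  move=> Vv Vv' E; have [qq|qq] := eqVneq q q'.
    by split=> //; move: E; rewrite qq => /addIr.
  case: Vx; have -> : x = ratr (q - q')^-1 * (ratr (- 1) * v + v') + 0.
    have d0 : ratr (q - q') != 0 :> R by rewrite fmorph_eq0 subr_eq0.
    apply: (mulfI d0); rewrite addr0 mulrA -rmorphM /= mulfV ?subr_eq0 //.
    rewrite rmorph1 mul1r rmorphB rmorphN rmorph1 /= mulN1r mulrBl.
    have -> : ratr q * x = v' + ratr q' * x - v by rewrite -E addrAC subrr add0r.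
    by ring.
  by apply: (VL) => //; apply: VL.
pose V' := [set y | exists2 p : R * rat, V p.1 & y = p.1 + ratr p.2 * x].
pose dec y := xget (0, 0) [set p : R * rat | V p.1 /\ y = p.1 + ratr p.2 * x].
pose l' y := l (dec y).1 + (dec y).2 * r.
have l'E v q : V v -> l' (v + ratr q * x) = l v + q * r.
  move=> Vv; have [|Vd dE] :=
      @xgetPex _ (0, 0) [set p : R * rat | V p.1 /\
        v + ratr q * x = p.1 + ratr p.2 * x].
    by exists (v, q).
  by rewrite /l'; have [<- <-] := uniq _ _ _ _ Vv Vd dE.
have l'V v : V v -> l' v = l v.
  by move=> Vv; have := l'E v 0 Vv; rewrite rmorph0 !mul0r !addr0.
have combE q v a w b : ratr q * (v + ratr a * x) + (w + ratr b * x) =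
    (ratr q * v + w) + ratr (q * a + b) * x.
  by rewrite rmorphD rmorphM /=; ring.
exists V', l'; split=> //.
- split.
  + by exists (0, 0) => //=; rewrite rmorph0 mul0r addr0.
  + move=> q _ _ [[v a] /= Vv ->] [[w b] /= Vw ->]; rewrite combE.
    by exists (ratr q * v + w, q * a + b) => //=; apply: VL.
  + move=> q _ _ [[v a] /= Vv ->] [[w b] /= Vw ->].
    by rewrite combE !l'E ?lL //; [ring|apply: VL].
- by move=> v Vv; exists (v, 0) => //=; rewrite rmorph0 mul0r addr0.
- by exists (0, 1) => //=; rewrite rmorph1 mul1r add0r.
- by have := l'E 0 1 V0; rewrite rmorph1 !mul1r !add0r l0 add0r.
Qed.

(** A dual basis argument: starting from the line of [x0], the functional is
    extended by zero to each element of [s] outside the current span. *)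
Lemma rat_functional (R : numFieldType) (x0 : R) (s : seq R) : x0 != 0 ->
  exists V l, [/\ rat_linear_on V l, forall x, x \in s -> V x, V x0 & l x0 = 1].
Proof.
move=> x00; elim: s => [|x s [V [l [lV sV Vx0 lx0]]]].
  (* The line of [x0] is itself an extension, of the zero subspace. *)
  have lin0 : rat_linear_on [set (0 : R)] (fun=> 0).
    split=> // [q x y /= -> ->|q x y _ _]; first by rewrite mulr0 addr0.
    by rewrite mulr0 addr0.
  have [|V [l [lV _ Vx0 _ lx0]]] := @rat_linear_extend _ _ _ x0 1 lin0.
    exact/eqP.
  by exists V, l.
have [Vx|Vx] := pselect (V x).
  by exists V, l; split=> // y; rewrite inE => /orP[/eqP->//|/sV].
have [V' [l' [l'V VV' V'x l'l _]]] := rat_linear_extend 0 lV Vx.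
exists V', l'; split=> //; last by rewrite l'l.
  by move=> y; rewrite inE => /orP[/eqP->//|/sV/VV'].
exact: VV'.
Qed.

(** A rational functional on the span of the values of [c] turns [c] into a
    rational character; on a finitely generated group the product of the
    denominators at the generators clears all denominators. *)
Lemma int_char_of_real (R : numFieldType) (G : groupType) (c : G -> R) g0 :
  fg_group G -> additive_char c -> c g0 != 0 ->
  exists chi : G -> int, [/\ additive_char chi, chi g0 != 0 &
    forall g, c g = 0 -> chi g = 0].
Proof.
move=> [sG genG] cM cg0.
have [V [l [lV sV _ lg0]]] := rat_functional (map c sG) cg0.
have l0 := rat_linear0 lV; case: lV => V0 VL lL.
have cV g : V (c g).
  have : [set: G] g by []. rewrite -genG; move: g.
  apply: (@generated_min _ _ (c @^-1` V)); last first.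
    by move=> x /= xG; apply: sV; apply: map_f.
  apply/subgroupP; split=> [|x y /= Vx Vy|x /= Vx].
  - by rewrite /= char1.
  - by rewrite cM; have := VL 1 _ _ Vx Vy; rewrite rmorph1 mul1r.
  - by rewrite charV //; have := VL (- 1) _ _ Vx V0;
      rewrite rmorphN rmorph1 mulN1r addr0.
pose psi g := l (c g).
have psiM : additive_char psi.
  move=> x y; rewrite /psi cM; have := lL 1 _ _ (cV x) (cV y).
  by rewrite rmorph1 !mul1r.
pose D := \prod_(x <- sG) denq (psi x).
have D0 : D != 0 by rewrite prodf_seq_neq0; apply/allP => x _; rewrite denq_neq0.
pose chi g := numq (D%:~R * psi g).
have chiE g : (chi g)%:~R = D%:~R * psi g.
  suff : D%:~R * psi g \is a Num.int by move/numqK.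
  have : [set: G] g by []. rewrite -genG; move: g.
  apply: (@generated_min _ _ [set g | D%:~R * psi g \is a Num.int]).
    apply/subgroupP; split=> [|x y /= Hx Hy|x /= Hx].
    - by rewrite /= char1 // mulr0 rpred0.
    - by rewrite psiM mulrDr rpredD.
    - by rewrite charV // mulrN rpredN.
  move=> x /= xG; rewrite /D (big_rem x) //= intrM mulrAC -{2}(divq_num_den (psi x)).
  rewrite [_ * (_ / _)]mulrC mulfVK ?intr_eq0 ?denq_neq0 //.
  by rewrite -intrM rpred_int.
have inj := @intr_inj rat.
exists chi; split.
- by move=> x y; apply: inj; rewrite rmorphD /= !chiE psiM mulrDr.
- rewrite -(inj_eq inj) chiE /psi lg0 mulr1 intr_eq0 //.
- by move=> g cg; apply: inj; rewrite chiE /psi cg l0 mulr0.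
Qed.

(** * Betti numbers *)

Lemma cocycle_additive (R : realType) (G : groupType) (c : G -> R^o) :
  cocycles1 c <-> additive_char c.
Proof.
split=> cP x y; have := cP x y; rewrite /cobord1.
  by move=> E; apply/eqP; rewrite -subr_eq0 -oppr_eq0 -E; apply/eqP; ring.
by move=> ->; ring.
Qed.

Lemma coboundaries1E (R : realType) (G : groupType) :
  @coboundaries1 R G = [set 0].
Proof.
apply/seteqP; split=> [_ [r _ <-]|_ ->].
  by apply/funext => g; rewrite /cobord0 subrr.
by exists 0 => //; apply/funext => g; rewrite /cobord0 subrr.
Qed.

Lemma b1_basis (R : realType) (G : groupType) : (0 < b1 R G)%N ->
  exists c : 'I_(b1 R G) -> G -> R^o,
    [/\ forall i, additive_char (c i),
        forall a : 'I_(b1 R G) -> R, (forall g, \sum_i a i * c i g = 0) ->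
          forall i, a i = 0
      & forall z : G -> R^o, additive_char z ->
          exists a : 'I_(b1 R G) -> R, forall g, z g = \sum_i a i * c i g].
Proof.
move=> b_gt0; have : quotient_dim (@cocycles1 R G) (@coboundaries1 R G) (b1 R G).
  move: b_gt0; rewrite /b1; case: xgetP => [n _ //|]; by rewrite ltnn.
rewrite coboundaries1E => -[c [cZ cfree cgen]]; exists c.
have sumE (a : 'I_(b1 R G) -> R) g :
    (\sum_i a i *: c i) g = \sum_i a i * c i g.
  by rewrite fct_sumE.
split=> [i|a az|z zM]; first exact/cocycle_additive.
- by apply: cfree; apply/funext => g; rewrite sumE az.
- have /cocycle_additive/cgen[a E] := zM; exists a => g.
  by rewrite -sumE; apply: subr0_eq; have := congr1 (fun z => z g) E.
Qed.

(** Otherwise all characters of [G] descend to [Gamma], and expressing a basis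
    for [G] in a basis for [Gamma] gives a matrix with more rows than columns,
    whose left kernel contradicts independence. *)
Lemma char_nonzero_on_kernel (R : realType) (G Gamma : groupType)
    (f : {multiplicative G -> Gamma}) :
  epimorphism f -> (0 < b1 R Gamma)%N -> (b1 R Gamma < b1 R G)%N ->
  exists (c : G -> R) (k : G), [/\ additive_char c, f k = 1%g & c k != 0].
Proof.
move=> fsurj bGamma bG; apply: contrapT => none.
have vanish (c : G -> R^o) k : additive_char c -> f k = 1%g -> c k = 0.
  by move=> cM fk; apply/eqP; apply: contrapT => /negP ck; apply: none; exists c, k.
have [c [cM cfree _]] := b1_basis (ltn_trans bGamma bG).
have [e [_ _ egen]] := b1_basis bGamma.
have [sec fsec] := choice fsurj.
have desc i : exists a : 'I_(b1 R Gamma) -> R,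
    forall g, c i g = \sum_j a j * e j (f g).
  have cf g h : f g = f h -> c i g = c i h.
    move=> fgh; apply/eqP; rewrite -subr_eq0 -charV // -cM.
    apply/eqP; apply: (vanish _ _ (cM i)); rewrite gmulfM.
    by rewrite (group_morphV (@gmulfM _ _ f)) fgh mulgV.
  have [|a aE] := egen (fun y => c i (sec y)).
    by move=> x y; rewrite -cM; apply: cf; rewrite gmulfM !fsec.
  by exists a => g; rewrite -aE; apply: cf; rewrite fsec.
have [a aE] := choice desc.
pose A : 'M[R]_(b1 R G, b1 R Gamma) := \matrix_(i, j) a i j.
have /rowV0Pn[u /sub_kermxP uA u0] : kermx A != 0.
  rewrite kermx_eq0 /row_free neq_ltn; apply/orP; left.
  exact: leq_ltn_trans (rank_leq_col A) bG.
case/eqP: u0; apply/rowP => i; rewrite mxE.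
apply: (cfree (fun i => u 0 i)) => g.
under eq_bigr do rewrite aE mulr_sumr.
rewrite exchange_big big1 //= => j _.
under eq_bigr do rewrite mulrA.
rewrite -mulr_suml; move/matrixP/(_ 0 j): uA; rewrite !mxE.
by under eq_bigr do rewrite mxE; move=> ->; rewrite mul0r.
Qed.

(** * The fibration theorem *)

Theorem theorem1 (R : realType) (K G Gamma : groupType)
    (i : {multiplicative K -> G}) (f : {multiplicative G -> Gamma})
    (hG : fg_group G) (hK : fg_group K)
    (hext : group_extension i f)
    (hb : (b1 R Gamma < b1 R G)%N) (hb0 : (0 < b1 R Gamma)%N) :
  algebraically_fibers G.
Proof.
have [_ imK fsurj] := hext; have [sG genG] := hG; have [sK genK] := hK.
have [c [h [cM fh ch]]] := char_nonzero_on_kernel fsurj hb0 hb.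
have [e [eM efree _]] := b1_basis hb0.
have [j [y ejy]] : exists j y, e j y != 0.
  apply: contrapT => none; have j0 : 'I_(b1 R Gamma) := Ordinal hb0.
  have := oner_neq0 R; rewrite (efree (fun=> 1) _ j0) ?eqxx // => g.
  rewrite big1 // => j _; rewrite mul1r; apply/eqP.
  by apply: contrapT => /negP ejg; apply: none; exists j, g.
have [t ft] := fsurj y.
have efM : additive_char (e j \o f : G -> R).
  by move=> a b /=; rewrite gmulfM eM.
have eft : (e j \o f : G -> R) t != 0 by rewrite /= ft.
have [alpha [aM ah _]] := int_char_of_real hG cM ch.
have [beta [bM bt bN]] := int_char_of_real hG efM eft.
pose N := hom_kernel f.
have sN : subgroup N.
  apply: (@subgroup_preimage _ _ f [set 1%g] (@gmulfM _ _ f)).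
  apply/subgroupP; split=> [|a b|a] /=.
  - by [].
  - by move=> -> ->; rewrite mulg1.
  - by move=> ->; rewrite invg1.
have nN a g : N a -> N (a ^ g)%g.
  rewrite /N /hom_kernel /= conjgE !gmulfM => ->.
  by rewrite mul1g -gmulfM mulVg (group_morph1 (@gmulfM _ _ f)).
have defN : N = generated [set` map i sK].
  apply/seteqP; split; last first.
    apply: (generated_min sN) => _ /mapP[a _ ->].
    by rewrite /N -imK; exists a.
  rewrite /N -imK => _ [a _ <-].
  have : [set: K] a by []. rewrite -genK; move: a.
  apply: (@generated_min _ _ (i @^-1` generated [set` map i sK])).
    by apply: subgroup_preimage; [exact: gmulfM|exact: generated_subgroup].
  by move=> a aK; apply: sub_generated; apply: map_f.
have bN' x : N x -> beta x = 0.
  by move=> fx; apply: bN; rewrite /= (fx : f x = 1%g) char1.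
have [chi chiM [[g chig] fgker]] :=
  exists_char_kernel_fg sN nN defN genG aM bM fh ah bN' bt.
exact: algebraically_fibers_of_char chiM chig fgker.
Qed.
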